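(* Let $d\ge 2$ and $n\ge 2$ be integers. For every $\mathbf{o}$-symmetric convex body $\mathbf{K}_0$ in $\mathbb{R}^d$ and every NS-family $\mathcal{K}=\{\mathbf{x}_i+\tau_i\mathbf{K}_0 : \mathbf{x}_i\in\mathbb{R}^d,\ \tau_i>0,\ i=1,2,\ldots,n\}$ the inequality $\lambda(\mathcal{K})\le 1$ holds.
   Context: A convex body in $\mathbb{R}^d$ is a compact convex subset of $\mathbb{R}^d$ with non-empty interior; it is $\mathbf{o}$-symmetric if it is symmetric about the origin $\mathbf{o}$. The family $\mathcal{K}$ of positive homothetic copies of $\mathbf{K}_0$ is called a non-separable family, in short an NS-family, if every hyperplane of $\mathbb{R}^d$ that intersects $\operatorname{conv}\left(\bigcup\mathcal{K}\right)$ intersects a member of $\mathcal{K}$ (equivalently, no hyperplane disjoint from $\bigcup\mathcal{K}$ strictly separates some members of $\mathcal{K}$ from all the other members). For an NS-family, $\lambda(\mathcal{K})>0$ denotes the smallest positive value $\lambda$ such that some translate of $\lambda\left(\sum_{i=1}^n\tau_i\right)\mathbf{K}_0$ covers $\bigcup\mathcal{K}$. *)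

(* Defs.v *)
From mathcomp Require Import all_boot all_order all_algebra.
From mathcomp Require Import all_classical all_reals all_analysis.
Set Implicit Arguments.
Unset Strict Implicit.
Unset Printing Implicit Defensive.
Import Order.TTheory GRing.Theory Num.Theory.
Import numFieldNormedType.Exports.
Local Open Scope classical_set_scope.
Local Open Scope ring_scope.

Definition convex_body (R : realType) (d : nat) (K : set 'rV[R]_d) : Prop :=
  [/\ compact K, convex_set K & K° !=set0].

Definition o_symmetric (R : realType) (d : nat) (K : set 'rV[R]_d) : Prop :=
  forall y, K y -> K (- y).

Definition convex_hull (R : realType) (d : nat) (A : set 'rV[R]_d) :
  set 'rV[R]_d := smallest (@convex_set R 'rV[R]_d) A.

Definition hyperplane (R : realType) (d : nat) (H : set 'rV[R]_d) : Prop :=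
  exists (u : 'rV[R]_d) (c : R),
    u != 0 /\ H = [set p : 'rV[R]_d | \sum_i u ord0 i * p ord0 i = c].

Definition homothet (R : realType) (d : nat) (K : set 'rV[R]_d)
  (x : 'rV[R]_d) (t : R) : set 'rV[R]_d := [set x + t *: y | y in K].

Definition NS_family (R : realType) (d n : nat)
    (F : 'I_n -> set 'rV[R]_d) : Prop :=
  forall H : set 'rV[R]_d, hyperplane H ->
    H `&` convex_hull (\bigcup_i F i) !=set0 ->
    exists i, H `&` F i !=set0.

Definition covering_factors (R : realType) (d n : nat) (K0 : set 'rV[R]_d)
    (x : 'I_n -> 'rV[R]_d) (tau : 'I_n -> R) : set R :=
  [set l | 0 < l /\ exists v : 'rV[R]_d,
    \bigcup_i homothet K0 (x i) (tau i)
      `<=` homothet K0 v (l * \sum_i tau i)].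

(* lambda is a minimum, not merely an infimum, so it is given as a relation
   rather than as a total function with a junk value. *)
Definition is_lambda (R : realType) (d n : nat) (K0 : set 'rV[R]_d)
    (x : 'I_n -> 'rV[R]_d) (tau : 'I_n -> R) (l : R) : Prop :=
  covering_factors K0 x tau l /\ lbound (covering_factors K0 x tau) l.

Lemma is_lambda_inj (R : realType) (d n : nat) (K0 : set 'rV[R]_d)
    (x : 'I_n -> 'rV[R]_d) (tau : 'I_n -> R) (l1 l2 : R) :
  is_lambda K0 x tau l1 -> is_lambda K0 x tau l2 -> l1 = l2.
Proof.
move=> [f1 b1] [f2 b2].
by apply/eqP; rewrite eq_le (b1 _ f2) (b2 _ f1).
Qed.

(* Main.v *)
Require Import Defs.
From mathcomp Require Import all_boot all_order all_algebra.
From mathcomp Require Import all_classical all_reals all_analysis.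
From mathcomp Require Import ring lra.
Import Order.TTheory GRing.Theory Num.Theory.
Import numFieldNormedType.Exports.
Local Open Scope classical_set_scope.
Local Open Scope ring_scope.

(** Why the theorem is true.  The body [v + T K0], where [T] is the sum of the
    [tau i] and [v] is the mean of the centres [x i] with weights [tau i],
    already contains the whole family, so [lambda <= 1].

    Containment in a compact convex set can be tested one direction [u] at a
    time ([strict_separation]).  In direction [u] the member [x i + tau i K0]
    projects onto the interval with centre [dot u (x i)] and radius [tau i * h],
    where [- h] is the minimum of [dot u] on the symmetric body [K0].
    Non-separability forbids gaps in the union of these intervals
    ([NS_projection_gap_free]), and everything reduces to a statement on the
    line: if intervals with radii [w i * h] have a connected union, then the
    interval of radius [(\sum_i w i) * h] around the [w]-weighted mean of the
    centres reaches past every left end ([weighted_center_le]).  Using the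
    direction [- u] instead gives the right ends, so only left ends are treated.

    On the line, write [a i] for the left ends.  Since there is no gap, the
    stretch from any left end [a m] up to [a i] is covered by the intervals
    starting before [a i], hence is no longer than the sum of their lengths
    ([left_end_le_lengths]).  Averaging this over [i] with weights [w i] counts
    every unordered pair of distinct indices at most once, with factor
    [2 * w i * w j], and so stays below the square of [\sum_i w i]
    ([sum_ordered_pairs_le]).

    The smallest factor [lambda] exists by compactness of the set of admissible
    pairs (factor, centre) with factor in [0, 1] ([minimal_covering]); it is
    positive because [K0] has more than one point. *)

(** * Intervals on a line without gaps *)

(** The intervals with centres [c i] and radii [r i] have a connected union.
    It suffices to ask that points between two centres be covered: a gap has
    whole intervals, hence centres, on both sides. *)
Definition gap_free {R : realFieldType} {I : finType} (c r : I -> R) : Prop :=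
  forall s, (exists i, c i <= s) -> (exists j, s <= c j) ->
    exists k, `|s - c k| <= r k.

(** The stretch between two left ends is covered by the intervals that start
    before the later one.  Induction on the number of intervals starting before
    [i]: among them, one reaching furthest right must reach [c i - r i], and the
    induction hypothesis applies to its own left end. *)
Lemma left_end_le_lengths {R : realFieldType} {I : finType} (c r : I -> R) :
  (forall i, 0 <= r i) -> gap_free c r ->
  forall i m, (c i - r i) - (c m - r m) <=
    \sum_(j | c j - r j < c i - r i) r j *+ 2.
Proof.
move=> r_ge0 nogap i m; pose a j := c j - r j; rewrite -!/(a _).
have [N] := ubnP #|[pred j | a j < a i]|.
elim: N i => // N IHN i; rewrite ltnS => leN.
have [j0 j0lt|alast] := pickP (fun j => a j < a i); last first.
  rewrite big_pred0; last exact: alast.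
  by rewrite subr_le0 leNgt; have /= := alast m; rewrite /a => ->.
pose j := [arg max_(j > j0 | a j < a i) (c j + r j)]%O.
have [j_lt j_max] : a j < a i /\ forall k, a k < a i -> c k + r k <= c j + r j.
  by rewrite /j; case: arg_maxP.
have reach : a i <= c j + r j.
  rewrite leNgt; apply/negP => gap.
  (* the midpoint of the gap would be covered by an interval reaching further *)
  have [||k] := nogap ((c j + r j + a i) / 2).
  - by exists j; move: (r_ge0 j) gap; rewrite /a; lra.
  - by exists i; move: (r_ge0 i) gap; rewrite /a; lra.
  rewrite ler_norml => /andP[lo hi].
  have k_lt : a k < a i by move: hi lo gap; rewrite /a; lra.
  by move: (j_max k k_lt) lo hi gap; rewrite /a; lra.
have fewer : (#|[pred k | (a k < a j)%R]| < N)%N.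
  apply: leq_trans leN; apply: proper_card; apply/properP; split.
    by apply/fintype.subsetP => k; rewrite !inE => /lt_trans; apply.
  by exists j; rewrite !inE // ltxx.
have IHj := IHN j fewer.
rewrite (bigD1 j) //=.
have : \sum_(k | a k < a j) r k *+ 2 <= \sum_(k | (a k < a i) && (k != j)) r k *+ 2.
  rewrite [leRHS](bigID (fun k => a k < a j)) /=.
  rewrite [X in _ <= X + _](eq_bigl (fun k => a k < a j)).
    by rewrite lerDl; apply: sumr_ge0 => k _; rewrite mulrn_wge0.
  move=> k; apply/andP/idP => [[]//|k_lt]; split => //.
  by rewrite (lt_trans k_lt j_lt); apply: contraTneq k_lt => ->; rewrite ltxx.
by move: IHj reach; rewrite /a; lra.
Qed.

(** In the expanded square each product [w i * w j] with [i != j] occurs for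
    both orders of [i] and [j]; the left side keeps one order, doubled, and
    drops the pairs tied under [a]. *)
Lemma sum_ordered_pairs_le {R : realFieldType} {I : finType} (w a : I -> R) :
  (forall i, 0 <= w i) ->
  \sum_i w i ^+ 2 + \sum_i w i * (\sum_(j | a j < a i) w j *+ 2) <=
  (\sum_i w i) ^+ 2.
Proof.
move=> w_ge0.
have -> : \sum_i w i * (\sum_(j | a j < a i) w j *+ 2) =
    \sum_i \sum_j w i * w j *+ ((a j < a i)%R + (a i < a j)%R).
  transitivity ((\sum_i \sum_j w i * w j *+ (a j < a i)%R) +
                (\sum_i \sum_j w i * w j *+ (a i < a j)%R)).
    have -> : \sum_i \sum_j w i * w j *+ (a i < a j)%R =
        \sum_i \sum_j w i * w j *+ (a j < a i)%R.
      rewrite exchange_big; apply: eq_bigr => i _; apply: eq_bigr => j _ /=.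
      by rewrite mulrC.
    rewrite -mulr2n -sumrMnl.
    apply: eq_bigr => i _; rewrite sumrMnl mulrnAr; congr (_ *+ 2).
    rewrite mulr_sumr big_mkcond; apply: eq_bigr => j _.
    by case: ifP => _; rewrite ?mulr1n ?mulr0n.
  rewrite -big_split; apply: eq_bigr => i _ /=.
  by rewrite -big_split; apply: eq_bigr => j _; rewrite mulrnDr.
rewrite -big_split /= expr2 mulr_suml; apply: ler_sum => i _.
rewrite mulr_sumr (bigD1 i) //= ltxx mulr0n add0r [leRHS](bigD1 i) //= expr2.
rewrite lerD2l; apply: ler_sum => j _.
by case: ltgtP => _; rewrite ?mulr1n // mulr0n mulr_ge0.
Qed.

(** Divided by the total weight: the interval of radius [(\sum_i w i) * h]
    around the weighted mean starts no later than any interval of the family.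
    Averaging with the
    [w i] rather than with the radii [w i * h] leaves room for [h = 0]. *)
Lemma weighted_center_le {R : realFieldType} {I : finType} (c w : I -> R) (h : R) :
  (forall i, 0 <= w i) -> 0 <= h -> gap_free c (fun i => w i * h) ->
  forall m, \sum_i w i * c i <=
    (\sum_i w i) * (c m - w m * h) + (\sum_i w i) ^+ 2 * h.
Proof.
move=> w_ge0 h_ge0 nogap m.
pose a i := c i - w i * h.
have ends i : a i - a m <= (\sum_(j | a j < a i) w j *+ 2) * h.
  rewrite mulr_suml; under eq_bigr do rewrite mulrnAl.
  by apply: left_end_le_lengths => // j; exact: mulr_ge0.
have -> : \sum_i w i * c i = (\sum_i w i) * a m +
    (\sum_i w i ^+ 2 * h + \sum_i w i * (a i - a m)).
  rewrite mulr_suml -!big_split; apply: eq_bigr => i _ /=.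
  by rewrite /a; ring.
rewrite lerD2l; apply: le_trans (ler_wpM2r h_ge0 (@sum_ordered_pairs_le _ _ w a w_ge0)).
rewrite mulrDl !mulr_suml lerD2l; apply: ler_sum => i _.
by rewrite -mulrA ler_wpM2l.
Qed.

(** * Separating a point from a convex body *)

Definition dot {R : realType} {d : nat} (u p : 'rV[R]_d) : R :=
  \sum_i u ord0 i * p ord0 i.

Lemma dotC {R : realType} {d : nat} (u p : 'rV[R]_d) : dot u p = dot p u.
Proof. by apply: eq_bigr => i _; rewrite mulrC. Qed.

Lemma dotDr {R : realType} {d : nat} (u p q : 'rV[R]_d) :
  dot u (p + q) = dot u p + dot u q.
Proof. by rewrite -big_split; apply: eq_bigr => i _; rewrite mxE mulrDr. Qed.

Lemma dotZr {R : realType} {d : nat} (t : R) (u p : 'rV[R]_d) :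
  dot u (t *: p) = t * dot u p.
Proof. by rewrite mulr_sumr; apply: eq_bigr => i _; rewrite mxE mulrCA. Qed.

Lemma dotNr {R : realType} {d : nat} (u p : 'rV[R]_d) : dot u (- p) = - dot u p.
Proof. by rewrite -scaleN1r dotZr mulN1r. Qed.

Lemma dot_sumr {R : realType} {d : nat} {I : finType} (u : 'rV[R]_d)
    (p : I -> 'rV[R]_d) : dot u (\sum_i p i) = \sum_i dot u (p i).
Proof.
apply: (big_morph _ (dotDr u)).
by rewrite -(scale0r 0) dotZr mul0r.
Qed.

Lemma dot_sqrD {R : realType} {d : nat} (u w : 'rV[R]_d) :
  dot (u + w) (u + w) = dot u u + dot u w *+ 2 + dot w w.
Proof. by rewrite dotDr ![dot (u + w) _]dotC !dotDr [dot w u]dotC; ring. Qed.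

Lemma dot_gt0 {R : realType} {d : nat} {u : 'rV[R]_d} : u != 0 -> 0 < dot u u.
Proof.
move=> u_neq0; rewrite lt_def sumr_ge0 ?andbT; last first.
  by move=> i _; rewrite -expr2 sqr_ge0.
apply: contra_neq u_neq0 => /eqP.
rewrite psumr_eq0 => [/allP u0|i _]; last by rewrite -expr2 sqr_ge0.
apply/rowP => i; rewrite mxE.
by have /= := u0 i (mem_index_enum i); rewrite mulf_eq0 orbb => /eqP.
Qed.

Lemma dot_continuous {R : realType} {d : nat} {T : topologicalType}
    (f g : T -> 'rV[R]_d) :
  continuous f -> continuous g -> continuous (fun p => dot (f p) (g p)).
Proof.
move=> cf cg p.
apply: cvg_big => [|i _]; first exact: add_continuous.
have coord (e : T -> 'rV[R]_d) : continuous e -> continuous (fun z => e z ord0 i).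
  move=> ce z; apply: (@continuous_comp _ _ _ e (fun M => M ord0 i)) (ce z) _.
  exact: coord_continuous.
by apply: cvgM; [exact: (coord f) | exact: (coord g)].
Qed.

Lemma convex_setP {R : realType} {d : nat} {K : set 'rV[R]_d} {y z : 'rV[R]_d} {t : R} :
  convex_set K -> K y -> K z -> 0 <= t <= 1 -> K (t *: y + (1 - t) *: z).
Proof.
move=> cK Ky Kz /andP[t0 t1].
by have /set_mem := cK y z (Itv01 t0 t1) (mem_set Ky) (mem_set Kz).
Qed.

Lemma convex_body_min {R : realType} {d : nat} {K : set 'rV[R]_d}
    (f : 'rV[R]_d -> R) :
  convex_body K -> continuous f ->
  exists2 y, K y & forall z, K z -> f y <= f z.
Proof.
move=> [cK _ [y0 /interior_subset Ky0]] cf.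
have [||y /set_mem Ky ymin] := @EVT_min_rV _ _ f K _ cK.
- by exists y0.
- exact: continuous_subspaceT.
by exists y => // z Kz; apply: ymin; exact/mem_set.
Qed.

(** The normal is [y0 - q] for [y0] a point of [K] nearest to [q]: a point of
    [K] on the wrong side would make a short step from [y0] towards it decrease
    the distance to [q]. *)
Lemma strict_separation {R : realType} {d : nat} {K : set 'rV[R]_d} {q : 'rV[R]_d} :
  convex_body K -> ~ K q ->
  exists2 u : 'rV[R]_d, u != 0 & forall y, K y -> dot u q < dot u y.
Proof.
move=> bK nKq; have [cK convK _] := bK.
have [|y0 Ky0 y0min] := convex_body_min (fun y => dot (y - q) (y - q)) bK.
  have subq : continuous (fun y : 'rV[R]_d => y - q).
    by move=> y; apply: (@cvgB _ _ _ (nbhs y)) => //; exact: cvg_cst.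
  exact: dot_continuous.
have u_neq0 : y0 - q != 0.
  by apply/eqP => /subr0_eq y0q; apply: nKq; rewrite -y0q.
exists (y0 - q) => // y Ky.
set u := y0 - q in u_neq0 *; set w := y - y0.
have uw_ge0 : 0 <= dot u w.
  have slope t : 0 < t <= 1 -> 0 <= dot u w *+ 2 + t * dot w w.
    move=> /andP[t_gt0 t_le1].
    have Kt : K (t *: y + (1 - t) *: y0).
      by apply: (convex_setP convK Ky Ky0); rewrite ltW.
    have := y0min _ Kt.
    have -> : t *: y + (1 - t) *: y0 - q = u + t *: w.
      by apply/rowP => i; rewrite !mxE; ring.
    rewrite (dot_sqrD u (t *: w)) !dotZr [dot (t *: w) w]dotC dotZr -/u => le_t.
    by rewrite -(pmulr_rge0 _ t_gt0); move: le_t; lra.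
  rewrite leNgt; apply/negP => uw_lt0.
  have ww_ge0 : 0 <= dot w w by apply: sumr_ge0 => i _; rewrite -expr2 sqr_ge0.
  (* with a = - dot u w > 0 and b = dot w w, the step a / (a + b) is at most 1
     and makes the slope at most - 2 a + a < 0 *)
  pose t := - dot u w / (- dot u w + dot w w).
  have den_gt0 : 0 < - dot u w + dot w w by lra.
  have t_gt0 : 0 < t by rewrite divr_gt0 // oppr_gt0.
  have := slope t; rewrite t_gt0 /= /t ler_pdivrMr // mul1r lerDl ww_ge0.
  move=> /(_ isT); apply/negP; rewrite -ltNge.
  have : t * dot w w <= - dot u w; last by rewrite /t; lra.
  rewrite /t mulrAC ler_pdivrMr // ler_wpM2l; lra.
have -> : y = q + u + w by rewrite /u /w; apply/rowP => i; rewrite !mxE; ring.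
by rewrite (dotDr u (q + u)) (dotDr u q); move: (dot_gt0 u_neq0); lra.
Qed.

(** * Symmetric bodies and non-separable families *)

Lemma convex_body_center {R : realType} {d : nat} {K : set 'rV[R]_d} :
  convex_body K -> o_symmetric K -> K 0.
Proof.
move=> [_ convK [y /interior_subset Ky]] symK.
have half : 0 <= (1 / 2 : R) <= 1 by apply/andP; split; lra.
have := convex_setP convK Ky (symK _ Ky) half.
by congr K; apply/rowP => i; rewrite !mxE; field.
Qed.

Lemma convex_body_neq0 {R : realType} {d : nat} {K : set 'rV[R]_d} :
  (0 < d)%N -> convex_body K -> exists2 z, K z & z != 0.
Proof.
case: d K => // d K _ [_ _ [y]].
have [->|y_neq0 /interior_subset Ky] := eqVneq y 0; last by exists y.
move=> /nbhs_ballP[e /= e_gt0 ballK].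
have e2_gt0 : 0 < e / 2 by rewrite divr_gt0.
exists (const_mx (e / 2)).
  apply: ballK; split=> // i j; rewrite !mxE /ball /= sub0r normrN gtr0_norm //.
  by rewrite ltr_pdivrMr // ltr_pMr // ltr1n.
by apply/eqP => /rowP/(_ ord0)/eqP; rewrite !mxE gt_eqF.
Qed.

(** Hyperplanes orthogonal to [u] are the points of the projection line.  One
    passing between two centres meets the segment joining them, hence the convex
    hull, hence by non-separability a member of the family. *)
Lemma NS_projection_gap_free {R : realType} {d n : nat} {K : set 'rV[R]_d}
    {x : 'I_n -> 'rV[R]_d} {tau : 'I_n -> R} {u : 'rV[R]_d} {h : R} :
  (forall i, 0 <= tau i) -> K 0 -> o_symmetric K ->
  (forall y, K y -> - h <= dot u y) -> u != 0 ->
  NS_family (fun i => homothet K (x i) (tau i)) ->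
  gap_free (fun i => dot u (x i)) (fun i => tau i * h).
Proof.
move=> tau_ge0 K0 symK hK u_neq0 NS s [i is_le] [j js_le].
have center k : homothet K (x k) (tau k) (x k).
  by exists 0 => //; rewrite scaler0 addr0.
have [||k [p [/= ps [y Ky pE]]]] := NS [set p | dot u p = s].
- by exists u, s.
- have [t /andP[t0 t1] st] : exists2 t, 0 <= t <= 1 &
      s = t * dot u (x i) + (1 - t) * dot u (x j).
    have [xij|xij] := eqVneq (dot u (x i)) (dot u (x j)).
      by exists 0; [rewrite lexx ler01 | lra].
    have pos : 0 < dot u (x j) - dot u (x i).
      by rewrite subr_gt0 lt_neqAle xij (le_trans is_le).
    exists ((dot u (x j) - s) / (dot u (x j) - dot u (x i))); last by field; lra.
    by rewrite divr_ge0 ?ler_pdivrMr //=; lra.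
  exists (t *: x i + (1 - t) *: x j); split.
    by rewrite /= dotDr !dotZr -st.
  move=> C [convC subC]; apply: convex_setP => //; last by rewrite t0.
  - by apply: subC; exists i.
  - by apply: subC; exists j.
- exists k; rewrite -ps -pE dotDr dotZr addrAC subrr add0r.
  rewrite normrM (ger0_norm (tau_ge0 k)) ler_wpM2l // ler_norml hK //=.
  by have := hK _ (symK _ Ky); rewrite dotNr lerN2.
Qed.

Definition weighted_center {R : realType} {d n : nat} (x : 'I_n -> 'rV[R]_d)
    (tau : 'I_n -> R) : 'rV[R]_d :=
  (\sum_i tau i)^-1 *: \sum_i tau i *: x i.

(** If a point [x m + tau m *: z] of the family were outside [v + T K], a
    direction [u] would put it below the whole of [v + T K], whereas by
    [weighted_center_le] the minimum of [dot u] over the member of index [m] is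
    at least the minimum over [v + T K]. *)
Lemma NS_covered {R : realType} {d n : nat} {K : set 'rV[R]_d}
    {x : 'I_n -> 'rV[R]_d} {tau : 'I_n -> R} :
  convex_body K -> o_symmetric K -> (forall i, 0 < tau i) ->
  NS_family (fun i => homothet K (x i) (tau i)) ->
  \bigcup_i homothet K (x i) (tau i) `<=`
    homothet K (weighted_center x tau) (\sum_i tau i).
Proof.
move=> bK symK tau_gt0 NS p [m _ [z Kz <-{p}]].
set T := \sum_i tau i; set v := weighted_center x tau.
have T_gt0 : 0 < T.
  by rewrite /T (bigD1 m) //= ltr_wpDr // sumr_ge0 // => i _; rewrite ltW.
pose q := T^-1 *: (x m + tau m *: z - v).
have pE : x m + tau m *: z = v + T *: q.
  by rewrite /q scalerA divff ?gt_eqF // scale1r addrCA subrr addr0.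
suff Kq : K q by exists q.
apply: contrapT => nKq.
have [u u_neq0 uK] := strict_separation bK nKq.
have cu : continuous (dot u).
  apply: (dot_continuous (cst u) id) => [|y]; last exact: cvg_id.
  exact: cst_continuous.
have [y0 Ky0 y0min] := convex_body_min (dot u) bK cu.
pose h := - dot u y0.
have hK y : K y -> - h <= dot u y by move=> Ky; rewrite opprK y0min.
have K0 := convex_body_center bK symK.
have h_ge0 : 0 <= h.
  by move: (y0min _ K0); rewrite -(scale0r 0) dotZr mul0r oppr_ge0.
have tau_ge0 i : 0 <= tau i by exact: ltW.
have nogap := NS_projection_gap_free tau_ge0 K0 symK hK u_neq0 NS.
have := weighted_center_le _ _ h tau_ge0 h_ge0 nogap m.
have -> : \sum_i tau i * dot u (x i) = T * dot u v.
  rewrite /v /weighted_center dotZr mulVKf ?gt_eqF // dot_sumr.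
  by apply: eq_bigr => i _; rewrite dotZr.
rewrite -/T expr2 -mulrA -mulrDr ler_pM2l //.
have : dot u (x m + tau m *: z) = dot u v + T * dot u q.
  by rewrite pE (dotDr u v) (dotZr T u q).
rewrite dotDr dotZr.
have : tau m * - h <= tau m * dot u z by rewrite ler_wpM2l // hK.
have : T * dot u q < T * - h by rewrite ltr_pM2l // opprK uK.
lra.
Qed.

(** * Existence of the smallest factor *)

(** For one point [p] the pairs [(l, v)] with [p] in [v + l T K] and [l] in
    [0, 1] form the image of the compact set [`[0, 1] `*` K] under the map
    [(l, y) |-> (l, p - l T y)].  The pairs that work for all of [U] form an
    intersection of such compact sets, on which the first coordinate attains its
    minimum.  The value [l = 0], at which [v + l T K] is a single point, is kept
    to make the set closed. *)
Lemma minimal_covering {R : realType} {d : nat} {K U : set 'rV[R]_d} {T : R} :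
  compact K -> (exists v, U `<=` homothet K v T) -> U !=set0 ->
  exists (l : R) (v : 'rV[R]_d), [/\ 0 <= l <= 1, U `<=` homothet K v (l * T) &
    forall l' v', 0 <= l' <= 1 -> U `<=` homothet K v' (l' * T) -> l <= l'].
Proof.
move=> cK [v0 cover0] [p0 Up0].
pose F (p : 'rV[R]_d) (ly : R * 'rV[R]_d) := (ly.1, p - (ly.1 * T) *: ly.2).
have cF p : continuous (F p).
  move=> [l y].
  have c1 : continuous (fun z : R * 'rV[R]_d => z.1) by move=> z; exact: cvg_fst.
  have c2 : continuous (fun z : R * 'rV[R]_d => z.2) by move=> z; exact: cvg_snd.
  apply: (@cvg_pair _ _ _ (nbhs (l,y)) (nbhs l) (nbhs (p - (l*T) *: y)) _ _ _ _ _ (c1 (l,y))).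
  apply: (@cvgB _ _ _ (nbhs (l,y))); first exact: cvg_cst.
  apply: (@cvgZ _ _ _ (nbhs (l,y))); last exact: (c2 (l,y)).
  apply: (@cvgM _ _ (nbhs (l,y))); first exact: (c1 (l,y)).
  exact: cvg_cst.
pose A p := F p @` ([set` `[0, 1]] `*` K).
have cA p : compact (A p).
  apply: continuous_compact; first exact: continuous_subspaceT.
  by apply: compact_setX => //; exact: segment_compact.
have inA p l v : A p (l, v) <-> 0 <= l <= 1 /\ homothet K v (l * T) p.
  split=> [[[l' y] [/= l01 Ky] [<- <-]]|[l01 [y Ky <-]]].
    by rewrite in_itv in l01; split=> //; exists y => //; rewrite subrK.
  exists (l, y); first by split=> //=; rewrite in_itv.
  by rewrite /F /= addrK.
pose B := \bigcap_(p in U) A p.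
have cB : compact B.
  apply: (subclosed_compact _ (cA p0)) => [|lv]; last exact.
  apply: closed_bigI => p _; apply: compact_closed (cA p).
  exact: norm_hausdorff.
have [||[l v] /set_mem Blv lmin] := @compact_EVT_min _ _ fst B _ cB.
- exists (1, v0) => p Up; apply/inA; rewrite ler01 lexx mul1r.
  by split=> //; exact: cover0.
- by apply: continuous_subspaceT => z; exact: cvg_fst.
exists l, v; split.
- by have [] := (inA p0 l v).1 (Blv p0 Up0).
- by move=> p Up; have [] := (inA p l v).1 (Blv p Up).
move=> l' v' l'01 cover'.
by apply: (lmin (l', v')); apply/mem_set => p Up; apply/inA; split=> //; exact: cover'.
Qed.

Theorem theorem4 (R : realType) (d n : nat) (hd : (2 <= d)%N) (hn : (2 <= n)%N)
    (K0 : set 'rV[R]_d) (hK0 : convex_body K0) (symK0 : o_symmetric K0)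
    (x : 'I_n -> 'rV[R]_d) (tau : 'I_n -> R) (tau_gt0 : forall i, 0 < tau i)
    (hNS : NS_family (fun i => homothet K0 (x i) (tau i))) :
  exists lambda : R, is_lambda K0 x tau lambda /\ lambda <= 1.
Proof.
pose i0 : 'I_n := Ordinal (ltnW hn).
have cover := NS_covered hK0 symK0 tau_gt0 hNS.
have [cK _ _] := hK0; have K00 := convex_body_center hK0 symK0.
have in_family i y : K0 y -> (\bigcup_i homothet K0 (x i) (tau i)) (x i + tau i *: y).
  by move=> Ky; exists i => //; exists y.
have [||l [v [/andP[l_ge0 l_le1] coverl lmin]]] := minimal_covering cK (T := \sum_i tau i)
  (U := \bigcup_i homothet K0 (x i) (tau i)).
- by exists (weighted_center x tau).
- by exists (x i0 + tau i0 *: 0); exact: in_family.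
exists l; split=> //; split.
  split; last by exists v.
  (* a zero factor would put the whole family at the single point v *)
  rewrite lt_neqAle l_ge0 andbT; apply/eqP => l0.
  have at_v p : (\bigcup_i homothet K0 (x i) (tau i)) p -> p = v.
    by move=> /coverl[y _ <-]; rewrite -l0 mul0r scale0r addr0.
  have [z Kz /negP[]] := convex_body_neq0 (ltnW hd) hK0.
  have := at_v _ (in_family i0 z Kz); rewrite -(at_v _ (in_family i0 0 K00)).
  move=> /addrI; rewrite scaler0 => /eqP.
  by rewrite scaler_eq0 (gt_eqF (tau_gt0 i0)).
move=> l' [l'_gt0 [v' cover']].
have [l'1|/ltW l'1] := leP l' 1; last exact: le_trans l_le1 l'1.
by apply: lmin cover'; rewrite (ltW l'_gt0).
Qed.
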